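(* (i) In the standard domain $(\mathbf{Euc},\mathbb{R})$, every generalized gradient flow $(l,-R[l]_1,s,\tau)$ such that $l$ is bounded below converges. (ii) Let $r$ be a dense subring of a real-closed field. In the $r$-polynomial domain $(\mathbf{Poly}_r,1)$, every generalized gradient flow $(l,-R[l]_1,s,\tau)$ such that $l$ is bounded below converges.
   Context: Standard domain $(\mathbf{Euc},\mathbb{R})$: $\mathbf{Euc}$ is the category of Euclidean spaces $\mathbb{R}^n$ and infinitely differentiable maps. Objectives are smooth maps $l:\mathbb{R}^n\to\mathbb{R}$; the generalized gradient is $R[l]_1=\nabla l$; for smooth $f:\mathbb{R}\to\mathbb{R}^n$, $D_1[f]=f'$. $r$-polynomial domain $(\mathbf{Poly}_r,1)$, for $r$ an ordered commutative ring: $\mathbf{Poly}_r$ has natural numbers as objects and morphisms $n\to m$ are $m$-tuples of polynomials in $n$ variables with coefficients in $r$. Objectives are polynomials $l: n\to 1$; the generalized gradient is $R[l]_1=\left(\frac{\partial l}{\partial x_1},\dots,\frac{\partial l}{\partial x_n}\right)$ (formal partial derivatives); for a tuple $f: 1\to n$ of one-variable polynomials, $D_1[f]$ is the tuple of formal derivatives. A dense subring of a real-closed field carries the induced order, and density is with respect to the order topology of the field. In either domain (with $K=\mathbb{R}$ or $K=r$ respectively), a generalized gradient flow $(l,-R[l]_1,s,\tau)$ consists of an objective $l$ in $n$ variables, a morphism $s$ from the one-dimensional object to the $n$-dimensional object (a smooth map $\mathbb{R}\to\mathbb{R}^n$, respectively an $n$-tuple of polynomials in one variable over $r$), and a nonempty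 interval $\tau\subseteq K$ such that $-R[l]_1(s(t))=D_1[s](t)$ for all $t\in\tau$. The objective $l$ is bounded below if there is $x\in K$ with $x\le l(a)$ for all $a\in K^n$. The flow converges if for every $\delta>0$ in $K$ there is $t\in\tau$ such that for all $t'\in\tau$ with $t\le t'$ one has $-\delta\le l(s(t'))-l(s(t))\le\delta$. *)

(* Defs.v *)
From HB Require Import structures.
From mathcomp Require Import all_boot all_order all_algebra.
From mathcomp Require Import all_classical all_reals all_analysis.
(* Not imported: the notations of mpoly clash with those of mathcomp-analysis *)
From mathcomp Require mpoly.

Set Implicit Arguments.
Unset Strict Implicit.
Unset Printing Implicit Defensive.

Import Order.TTheory GRing.Theory Num.Theory.
Import numFieldNormedType.Exports.

Local Open Scope classical_set_scope.
Local Open Scope ring_scope.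

(* The ordered ring K of scalars is a subset of an ordered field F: it is all *)
(* of F = R in the standard domain, and the subring r of F in Poly_r.         *)
Section GradientFlow.
Variables (F : realFieldType) (K : set F) (n : nat).
Implicit Types (l : 'rV[F]_n -> F) (s : F -> 'rV[F]_n) (tau : set F).

(* Interval of K = order-convex subset of K; no endpoints in K are required   *)
Definition nonempty_interval tau : Prop :=
  [/\ tau `<=` K, tau !=set0 &
      forall x y z, tau x -> tau y -> K z -> x <= z <= y -> tau z].

Definition bounded_below l : Prop :=
  exists2 x, K x &
    forall a : 'rV[F]_n, (forall i, K (a ord0 i)) -> x <= l a.

Definition flow_converges l s tau : Prop :=
  forall delta, K delta -> 0 < delta ->
    exists2 t, tau t &
      forall t', tau t' -> t <= t' ->
        - delta <= l (s t') - l (s t) <= delta.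

End GradientFlow.

Section Euc.
Variable R : realType.

(* In finite dimension, the differential x |-> 'd f x is k times              *)
(* differentiable iff each directional derivative x |-> 'd f x v is.          *)
Fixpoint k_times_differentiable (k : nat) (U V : normedModType R) (f : U -> V)
    : Prop :=
  if k is k'.+1 then
    (forall x, differentiable f x) /\
    (forall v, k_times_differentiable k' (fun x => 'D_v f x))
  else True.

Definition smooth (U V : normedModType R) (f : U -> V) : Prop :=
  forall k, k_times_differentiable k f.

Definition gradient (n : nat) (l : 'rV[R]_n -> R) (x : 'rV[R]_n) : 'rV[R]_n :=
  \row_(i < n) 'D_(delta_mx ord0 i) l x.

Definition euc_gradient_flow (n : nat) (l : 'rV[R]_n -> R)
    (s : R -> 'rV[R]_n) (tau : set R) : Prop :=
  [/\ smooth l, smooth s, nonempty_interval setT tau &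
      forall t, tau t -> - gradient l (s t) = derive1 s t].

End Euc.

Section Poly.
Variables (F : rcfType) (r : {pred F}) (n : nat).
Implicit Types (l : mpoly.mpoly n F) (s : 'I_n -> {poly F}).

Definition objective_fun l : 'rV[F]_n -> F :=
  fun a => mpoly.meval (a ord0) l.

Definition curve_fun s : F -> 'rV[F]_n := fun t => \row_(i < n) (s i).[t].

(* A morphism of Poly_r is a tuple of polynomials over F with coefficients in *)
(* r; its formal derivatives, taken over F, again have coefficients in r.     *)
Definition poly_gradient_flow l s (tau : set F) : Prop :=
  [/\ l \is a mpoly.mpolyOver n r,
      forall i, s i \is a polyOver r,
      nonempty_interval [set` r] tau &
      forall t, tau t -> forall i,
        - objective_fun (mpoly.mderiv i l) (curve_fun s t) = (s i)^`().[t]].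

Definition dense_subring : Prop :=
  subring_closed r /\ dense ([set` r] : set (order_topology F)).

End Poly.

(* Main.v *)
Require Import Defs.
From HB Require Import structures.
From mathcomp Require Import all_boot all_order all_algebra.
From mathcomp Require Import all_classical all_reals all_analysis.
From mathcomp Require mpoly polyrcf.
Import (canonicals) mpoly.

(* Along a gradient flow, d/dt l(s(t)) = -|grad l|^2 <= 0, so the objective    *)
(* is nonincreasing on tau. Over the reals it therefore comes within delta of  *)
(* its infimum. Over a dense subring the infimum need not exist; instead, if   *)
(* tau has two points, the polynomial identity p' = -(s_1'^2 + ... + s_n'^2)   *)
(* for p(t) = l(s(t)) holds at infinitely many points, hence everywhere, so p  *)
(* is nonincreasing on the whole field and bounded below on a cofinal subset:  *)
(* being a polynomial, p is constant.                                          *)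

Set Implicit Arguments.
Unset Strict Implicit.
Unset Printing Implicit Defensive.

Import Order.TTheory GRing.Theory Num.Theory.
Import numFieldNormedType.Exports.

Local Open Scope classical_set_scope.
Local Open Scope ring_scope.

(** In the smooth case, the chain rule and the mean value theorem give monotonicity
    ([euc_gradient_flow_nonincreasing]), and an infimum does the rest. In the polynomial case,
    [poly_gradient_flow_const] shows that two points in [tau] force the objective to be constant
    along the curve. Density of [r] enters twice there: it supplies enough points of [tau] to turn
    the flow equation into a polynomial identity, and it makes [r] cofinal, so that a lower bound
    known only on [r] excludes a limit of minus infinity. *)

Lemma nonincreasing_flow_converges (R : realType) (n : nat)
    (l : 'rV[R]_n -> R) (s : R -> 'rV[R]_n) (tau : set R) :
  tau !=set0 -> bounded_below setT l ->
  (forall x y, tau x -> tau y -> x <= y -> l (s y) <= l (s x)) ->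
  flow_converges setT l s tau.
Proof.
move=> [t0 tau_t0] [c _ c_le] l_s_le delta _ delta_gt0.
pose E := [set l (s t) | t in tau].
have E_inf : has_inf E.
  by split; [exists (l (s t0)); exists t0|exists c => _ [t _ <-]; exact: c_le].
(* From this [t] on, the values stay between [inf E] and [l (s t) < inf E + delta]. *)
have [_ [t tau_t <-] lt_inf] := inf_adherent delta_gt0 E_inf.
exists t => // t' tau_t' le_tt'; apply/andP; split; last first.
  by rewrite lerBlDl (le_trans (l_s_le _ _ tau_t tau_t' le_tt'))// lerDl ltW.
rewrite lerBrDr addrC lerBlDr (le_trans (ltW lt_inf))// lerD2r.
by apply: ge_inf; [exact: E_inf.2|exists t'].
Qed.

Lemma is_derive_gradient_comp (R : realType) (n : nat)
    (l : 'rV[R]_n -> R) (s : R -> 'rV[R]_n) (t : R) :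
  differentiable l (s t) -> differentiable s t ->
  is_derive t 1 (l \o s) (\sum_i derive1 s t 0 i * gradient l (s t) 0 i).
Proof.
move=> dl ds; have dls : differentiable (l \o s) t by exact: differentiable_comp.
apply: DeriveDef; first exact/derivable1_diffP.
rewrite deriveE// diff_comp//= -derive1E'//.
rewrite [in LHS](row_sum_delta (derive1 s t)) linear_sum /=.
by apply: eq_bigr => i _; rewrite linearZ /= mxE deriveE.
Qed.

Lemma euc_gradient_flow_nonincreasing (R : realType) (n : nat)
    (l : 'rV[R]_n -> R) (s : R -> 'rV[R]_n) (tau : set R) :
  euc_gradient_flow l s tau ->
  forall x y, tau x -> tau y -> x <= y -> l (s y) <= l (s x).
Proof.
move=> [l_smooth s_smooth [_ _ tau_itv] flow] x y tau_x tau_y le_xy.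
have dl a : differentiable l a by case: (l_smooth 1%N).
have ds a : differentiable s a by case: (s_smooth 1%N).
have [c c_xy ls_mvt] := MVT_segment le_xy
  (fun t _ => is_derive_gradient_comp (dl (s t)) (ds t))
  (continuous_subspaceT
    (fun t => differentiable_continuous (differentiable_comp (ds t) (dl (s t))))).
(* The point [c] lies in [tau] by order-convexity, so the flow equation turns each summand of the
   derivative into minus a square. *)
rewrite -subr_le0 [X in X <= 0]ls_mvt mulr_le0_ge0 ?subr_ge0//.
apply: sumr_le0 => i _; rewrite -flow.
  by rewrite mxE mulNr oppr_le0 -expr2 sqr_ge0.
by apply: (tau_itv x y).
Qed.

Section PolynomialFlow.
Variable F : rcfType.

(** Formal chain rule for substituting the curve into [l]. The polynomials obeying it include 1 and
    the variables and are closed under products, hence include all monomials; linearity does the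
    rest. *)
Lemma deriv_mmap (n : nat) (s : 'I_n -> {poly F}) (l : mpoly.mpoly n F) :
  (mpoly.mmap polyC s l)^`() =
  \sum_i mpoly.mmap polyC s (mpoly.mderiv i l) * (s i)^`().
Proof.
pose chain q := (mpoly.mmap polyC s q)^`() =
  \sum_i mpoly.mmap polyC s (mpoly.mderiv i q) * (s i)^`().
have chain1 : chain 1.
  rewrite /chain rmorph1 derivC big1// => i _.
  by rewrite -mpoly.mpolyC1 mpoly.mderivC rmorph0 mul0r.
have chainM p q : chain p -> chain q -> chain (p * q).
  rewrite /chain rmorphM/= derivM => -> ->.
  rewrite mulr_suml mulr_sumr -big_split/=; apply: eq_bigr => i _.
  rewrite mpoly.mderivM rmorphD/= !rmorphM/= mulrDl.
  by rewrite mulrAC mulrA.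
have chainX i : chain (mpoly.mpolyX F (mpoly.mnm1 i)).
  rewrite /chain mpoly.mmapX mpoly.mmap1U (bigD1 i)//= mpoly.mderivX.
  have -> : mpoly.mnm_sub (mpoly.mnm1 i) (mpoly.mnm1 i) = mpoly.mnm0.
    by apply/mpoly.mnmP => j; rewrite mpoly.mnmBE mpoly.mnm0E subnn.
  rewrite mpoly.mnm1E eqxx scale1r mpoly.mpolyX0 rmorph1 mul1r.
  rewrite big1 ?addr0// => j ji.
  by rewrite mpoly.mderivX mpoly.mnm1E eq_sym (negPf ji) scale0r rmorph0 mul0r.
elim/mpoly.mpolyind: l => [|c m p _ _ ih].
  by rewrite rmorph0 derivC big1// => i _; rewrite mpoly.mderiv0 rmorph0 mul0r.
have chainXm : chain (mpoly.mpolyX F m).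
  rewrite mpoly.mpolyXE_id; apply: (big_ind chain) => // i _.
  by elim: (mpoly.fun_of_multinom m i) => // k; rewrite exprS; exact: chainM.
rewrite rmorphD/= derivD ih mpoly.mmapZ mul_polyC derivZ chainXm scaler_sumr.
rewrite -big_split/=; apply: eq_bigr => i _.
by rewrite mpoly.mderivD mpoly.mderivZ rmorphD/= mpoly.mmapZ mul_polyC
  mulrDl scalerAl.
Qed.

Lemma horner_mmap (n : nat) (s : 'I_n -> {poly F}) (l : mpoly.mpoly n F) t :
  (mpoly.mmap polyC s l).[t] = objective_fun l (curve_fun s t).
Proof.
rewrite /objective_fun /mpoly.meval /mpoly.mmap horner_sum.
apply: eq_bigr => m _; rewrite hornerM hornerC; congr (_ * _).
rewrite /mpoly.mmap1 horner_prod; apply: eq_bigr => i _.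
by rewrite horner_exp mxE.
Qed.

Lemma le0_deriv_horner (p : {poly F}) :
  (forall x, p^`().[x] <= 0) -> forall x y, x <= y -> p.[y] <= p.[x].
Proof.
move=> p'_le0 x y; rewrite le_eqVlt => /predU1P[->//|lt_xy].
have [c _ mvt] := polyrcf.poly_mvt p lt_xy.
by rewrite -subr_le0 mvt mulr_le0_ge0// subr_ge0 ltW.
Qed.

(** A nonconstant polynomial tends to plus or minus infinity: the first contradicts [p.[x] <= p.[0]]
    for [x >= 0], the second the bound [c] at large elements of [r]. *)
Lemma nonincreasing_bounded_below_poly_const (r : {pred F}) (p : {poly F}) c :
  (forall x, exists2 y, y \in r & x <= y) ->
  (forall x y, x <= y -> p.[y] <= p.[x]) ->
  (forall x, x \in r -> c <= p.[x]) -> (size p <= 1)%N.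
Proof.
move=> r_cofinal p_le c_le; rewrite leqNgt; apply/negP => p_gt1.
have : lead_coef p != 0.
  by rewrite lead_coef_eq0 -size_poly_eq0 -lt0n (ltn_trans _ p_gt1).
rewrite neq_lt => /orP[lc_lt0|lc_gt0].
  (* The threshold [1 - c] forces [p <= c - 1] beyond [N]. *)
  have [||N N_le] := @polyrcf.poly_lim_infty _ (- p) (1 - c).
  - by rewrite lead_coefN oppr_gt0.
  - by rewrite size_polyN.
  have [y r_y /N_le] := r_cofinal N.
  by rewrite hornerN lerNr opprB leNgt ltrBlDr (le_lt_trans (c_le _ r_y))// ltrDl.
have [N N_le] := polyrcf.poly_lim_infty (p.[0] + 1) lc_gt0 p_gt1.
have := le_trans (N_le (Num.max N 0) _) (p_le 0 (Num.max N 0) _).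
by rewrite !le_max !lexx ?orbT => /(_ isT isT); rewrite leNgt ltrDl ltr01.
Qed.

Section DenseSubring.
Variable r : {pred F}.
Hypothesis r_dense : dense_subring r.

Lemma dense_subring_between x y : x < y -> exists2 z, z \in r & x < z < y.
Proof.
move=> lt_xy.
have [||z [/= z_xy r_z]] := r_dense.2 `]x, y[%classic.
- by exists ((x + y) / 2); rewrite /= in_itv/= !midf_lt.
- exact: (@itv_open _ (order_topology F)).
by exists z => //; move: z_xy; rewrite in_itv.
Qed.

Lemma dense_subring_cofinal x : exists2 y, y \in r & x <= y.
Proof.
have [y r_y /andP[/ltW le_xy _]] : exists2 y, y \in r & x < y < x + 1.
  by apply: dense_subring_between; rewrite ltrDl.
by exists y.
Qed.

Lemma dense_subring_horner (p : {poly F}) x :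
  p \is a polyOver r -> x \in r -> p.[x] \in r.
Proof.
have [r1 rB rM] := r_dense.1; move=> p_r r_x.
have r0 : 0 \in r by rewrite -(subrr 1) rB.
rewrite horner_coef; elim/big_ind: _ => // [a b ra rb|i _].
  by rewrite -[b]opprK rB// -sub0r rB.
apply: (rM); first exact/(allP p_r)/mem_nth.
by elim: (nat_of_ord i) => // k IHk; rewrite exprS rM.
Qed.

Lemma dense_subring_poly0 (p : {poly F}) x y : x < y ->
  (forall z, z \in r -> x < z < y -> p.[z] = 0) -> p = 0.
Proof.
move=> lt_xy p0; apply/eqP/negPn/negP => p_neq0.
have pts k : exists zs : seq F,
    [/\ size zs = k, uniq zs & all (fun z => (z \in r) && (x < z < y)) zs].
  (* The left end varies: later points are chosen to the right of [z], hence differ from it. *)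
  elim: k x lt_xy {p0} => [|k IHk] a lt_ay; first by exists [::].
  have [z r_z /andP[lt_az lt_zy]] := dense_subring_between lt_ay.
  have [zs [<- uniq_zs zs_zy]] := IHk z lt_zy.
  exists (z :: zs); split => //=.
    by rewrite uniq_zs andbT; apply/negP => /(allP zs_zy); rewrite ltxx /= andbF.
  rewrite r_z lt_az lt_zy /=; apply: sub_all zs_zy => w /andP[-> /andP[lt_zw ->]].
  by rewrite (lt_trans lt_az).
have [zs [size_zs uniq_zs zs_xy]] := pts (size p).
have zs_roots : all (root p) zs.
  by apply: sub_all zs_xy => z /andP[r_z z_xy]; apply/rootP/p0.
by have := max_poly_roots p_neq0 zs_roots uniq_zs; rewrite size_zs ltnn.
Qed.

Lemma poly_gradient_flow_const (n : nat) (l : mpoly.mpoly n F)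
    (s : 'I_n -> {poly F}) (tau : set F) x y :
  poly_gradient_flow r l s tau -> bounded_below [set` r] (objective_fun l) ->
  tau x -> tau y -> x < y ->
  forall t t', objective_fun l (curve_fun s t) = objective_fun l (curve_fun s t').
Proof.
move=> [_ s_r [_ _ tau_itv] flow] [c _ c_le] tau_x tau_y lt_xy.
pose p := mpoly.mmap polyC s l.
have p' : p^`() = - \sum_i (s i)^`() ^+ 2.
  apply/eqP; rewrite -addr_eq0; apply/eqP/(dense_subring_poly0 lt_xy) => z r_z.
  move=> /andP[/ltW le_xz /ltW le_zy].
  rewrite hornerD deriv_mmap !horner_sum -big_split/= big1// => i _.
  rewrite hornerM horner_mmap -[X in X * _]opprK flow.
    by rewrite horner_exp expr2 mulNr addNr.
  by apply: (tau_itv x y) => //; rewrite le_xz.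
have p_le : forall a b, a <= b -> p.[b] <= p.[a].
  apply: le0_deriv_horner => z; rewrite p' hornerN oppr_le0 horner_sum.
  by apply: sumr_ge0 => i _; rewrite horner_exp sqr_ge0.
(* The curve has coefficients in [r], so it sends [r] into the points where [l] is bounded below. *)
have p_const : (size p <= 1)%N.
  apply: (nonincreasing_bounded_below_poly_const dense_subring_cofinal p_le).
  move=> z r_z; rewrite horner_mmap; apply: c_le => i.
  by rewrite /= mxE; exact: dense_subring_horner.
by move=> t t'; rewrite -!horner_mmap -/p (size1_polyC p_const) !hornerC.
Qed.

End DenseSubring.
End PolynomialFlow.

Theorem mainTheorem4 :
  (forall (R : realType) (n : nat) (l : 'rV[R]_n -> R) (s : R -> 'rV[R]_n)
      (tau : set R),
    euc_gradient_flow l s tau ->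
    bounded_below setT l ->
    flow_converges setT l s tau)
  /\
  (forall (F : rcfType) (r : {pred F}),
    dense_subring r ->
    forall (n : nat) (l : mpoly.mpoly n F) (s : 'I_n -> {poly F})
      (tau : set F),
    poly_gradient_flow r l s tau ->
    bounded_below [set` r] (objective_fun l) ->
    flow_converges [set` r] (objective_fun l) (curve_fun s) tau).
Proof.
split=> [R n l s tau flow l_ge|F r r_dense n l s tau flow l_ge delta _ delta_gt0].
  apply: nonincreasing_flow_converges => //; last first.
    exact: euc_gradient_flow_nonincreasing.
  by have [_ _ []] := flow.
have [_ _ [_ [t tau_t] _] _] := flow.
(* Any [t] in [tau] serves: a later [t'] is either [t] itself or a second point of [tau], which
   forces constancy. *)
exists t => // t' tau_t'; rewrite le_eqVlt => /predU1P[->|lt_tt'].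
  by rewrite subrr oppr_le0 ltW.
rewrite (poly_gradient_flow_const r_dense flow l_ge tau_t tau_t' lt_tt' t' t).
by rewrite subrr oppr_le0 ltW.
Qed.
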